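(* For every integer $r\ge 3$ there exist propelinear perfect binary codes of length $2^{r+1}-1$ with kernel of dimension $2^{r+1}-2r-2$, and for every integer $r\ge 3$ there exist propelinear perfect binary codes of length $2^{r+1}-1$ that cannot be obtained by the Mollard construction, i.e. that are not equivalent to any perfect Mollard code.
   Context: $F=\mathrm{GF}(2)$; $F^n$ carries the Hamming metric; a code of length $n$ is a set of vectors of $F^n$, whose elements are called codewords. ${\bf 0}$ denotes the all-zero vector. A code $C\subseteq F^n$ is perfect if for every $x\in F^n$ there is exactly one $y\in C$ at Hamming distance at most $1$ from $x$. The kernel $\mathrm{Ker}(C)$ of a code $C$ of length $n$ is the set of all $x\in F^n$ with $x+C=C$ (a linear subspace). $\mathrm{Aut}(F^n)$ is the group of all transformations $(x,\pi)$, $x\in F^n$, $\pi$ a permutation of the coordinate positions, acting by $(x,\pi)(y)=x+\pi(y)$ where $\pi(y)=(y_{\pi^{-1}(1)},\ldots,y_{\pi^{-1}(n)})$. Two codes of length $n$ are equivalent if some element of $\mathrm{Aut}(F^n)$ maps one onto the other. $\mathrm{Aut}(C)$ is the setwise stabilizer of $C$ in $\mathrm{Aut}(F^n)$. A code $C$ is propelinear if $\mathrm{Aut}(C)$ has a subgroup of order $|C|$ acting transitively on the codewords of $C$. Mollard codes: let $C$ and $D$ be perfect codes of lengths $t$ and $m$ respectively, both containing the all-zero vector, and let $f:C\to F^m$ be any function. Index the coordinates of $F^{tm}$ by pairs $(i,j)$, $1\le i\le t$, $1\le j\le m$. Define $p_1:F^{tm}\to F^t$ and $p_2:F^{tm}\to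 F^m$ by $(p_1(x))_i=\sum_{j=1}^m x_{(i,j)}$, $(p_2(x))_j=\sum_{i=1}^t x_{(i,j)}$. Let $Z=\{(x|p_1(x)|p_2(x)):x\in F^{tm}\}$, where $|$ is concatenation. The (perfect) Mollard code of length $tm+t+m$ is $M(C,D)=\{({\bf 0}|y|z+f(y)): y\in C,\ z\in D\}+Z$. *)

(* Defs.v *)
From mathcomp Require Import all_boot all_order all_algebra all_fingroup.

Set Implicit Arguments.
Unset Strict Implicit.
Unset Printing Implicit Defensive.

Import GRing.Theory.
Local Open Scope ring_scope.

Notation "''BF_' n" := ('rV['F_2]_n) (at level 8, n at level 2, format "''BF_' n").

Section Codes.

Variable n : nat.
Implicit Types (C D : {set 'BF_n}) (x y : 'BF_n) (p : 'S_n).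

Definition hamming_dist x y : nat := #|[set i | x 0 i != y 0 i]|.

Definition perfect_code C : Prop :=
  forall x, exists! y, y \in C /\ (hamming_dist x y <= 1)%N.

Definition kernel C : {set 'BF_n} := [set x | [set x + y | y in C] == C].

Definition kernel_space C : {vspace 'BF_n} := <<enum (kernel C)>>%VS.

Lemma kernelP C x : reflect (forall y, y \in C -> x + y \in C) (x \in kernel C).
Proof.
rewrite inE; apply: (iffP eqP) => [eqC y Cy|sC].
  by rewrite -eqC; apply/imsetP; exists y.
apply/eqP; rewrite eqEcard card_imset ?leqnn ?andbT; last exact: addrI.
by apply/subsetP=> _ /imsetP[y Cy ->]; apply: sC.
Qed.

(* The kernel is already a subspace, so taking the span adds nothing. *)
Lemma mem_kernel_space C x : (x \in kernel_space C) = (x \in kernel C).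
Proof.
apply/idP/idP=> [xK|xK]; last by apply: memv_span; rewrite mem_enum.
rewrite (coord_span xK).
apply: (big_ind (fun v => v \in kernel C)) => [|u v /kernelP Ku /kernelP Kv|i _].
- by apply/kernelP=> y; rewrite add0r.
- by apply/kernelP=> y Cy; rewrite -addrA; apply/Ku/Kv.
have Ki : (enum_tuple (kernel C))`_i \in kernel C.
  by rewrite -mem_enum mem_nth // size_tuple.
have [a0 | a1] : coord (enum_tuple (kernel C)) i x = 0
             \/ coord (enum_tuple (kernel C)) i x = 1.
- by case: (coord _ _ _) => [[|[|k]] ltk] //; [left | right]; apply: val_inj.
- by rewrite a0 scale0r; apply/kernelP=> y; rewrite add0r.
- by rewrite a1 scale1r.
Qed.

(* [col_perm s y] has j-th entry [y (s j)], hence the inverse. *)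
Definition isometry_fun x p y : 'BF_n := x + col_perm p^-1 y.

Lemma isometry_fun_inj x p : injective (isometry_fun x p).
Proof.
move=> y z /addrI /rowP eq_yz; apply/rowP=> i.
by have := eq_yz (p i); rewrite !mxE permK.
Qed.

Definition isometry x p : {perm 'BF_n} := perm (@isometry_fun_inj x p).

Definition isometries : {set {perm 'BF_n}} :=
  [set isometry u.1 u.2 | u : 'BF_n * 'S_n].

(* The product of permutations composes left to right. *)
Lemma isometryM x p y q :
  (isometry x p * isometry y q)%g = isometry (isometry_fun y q x) (p * q).
Proof.
apply/permP=> z; rewrite permM !permE /isometry_fun; apply/rowP=> i.
by rewrite !mxE invMg permM addrA.
Qed.

Lemma isometries_group_set : group_set isometries.
Proof.
apply/group_setP; split.
  apply/imsetP; exists (0, 1%g) => //=; apply/permP=> z.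
  by rewrite !permE /isometry_fun invg1 col_perm1 add0r.
move=> _ _ /imsetP[[x p] _ ->] /imsetP[[y q] _ ->] /=.
rewrite isometryM; apply/imsetP.
by exists (isometry_fun y q x, (p * q)%g).
Qed.
Canonical isometries_group := Group isometries_group_set.

Definition code_aut C : {set {perm 'BF_n}} := 'N_isometries(C | 'P)%g.

Definition equivalent C D : Prop :=
  exists2 g, g \in isometries & [set g x | x : 'BF_n in C] = D.

Definition propelinear C : Prop :=
  exists G : {group {perm 'BF_n}},
    [/\ G \subset code_aut C, #|G| = #|C| & [transitive G, on C | 'P]%g].

End Codes.

Section Mollard.

Variables t m : nat.
Implicit Types x : 'M['F_2]_(t, m).

(* Vectors whose coordinates are indexed by pairs are t x m matrices,
   flattened by [mxvec]. *)
Definition row_parities x : 'BF_t := \row_i \sum_j x i j.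
Definition col_parities x : 'BF_m := \row_j \sum_i x i j.

Definition mollard_concat (u : 'BF_(t * m)) (v : 'BF_t) (w : 'BF_m) :
    'BF_(t * m + t + m) :=
  row_mx (row_mx u v) w.

Definition mollard_Z : {set 'BF_(t * m + t + m)} :=
  [set mollard_concat (mxvec x) (row_parities x) (col_parities x)
     | x : 'M['F_2]_(t, m)].

(* Only the values of f on C are used. *)
Definition mollard (C : {set 'BF_t}) (D : {set 'BF_m}) (f : 'BF_t -> 'BF_m) :
    {set 'BF_(t * m + t + m)} :=
  [set u + v | u in [set mollard_concat 0 y (z + f y) | y in C, z in D],
               v in mollard_Z].

End Mollard.

(* Lengths are positive: with t = 0 and C the only code of length 0, every
   perfect code D containing 0 would be a Mollard code. *)
Definition mollard_code n (M : {set 'BF_n}) : Prop :=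
  exists (t m : nat) (C : {set 'BF_t}) (D : {set 'BF_m}) (f : 'BF_t -> 'BF_m)
         (tm_n : (t * m + t + m)%N = n),
    [/\ (0 < t)%N /\ (0 < m)%N,
        perfect_code C /\ 0 \in C,
        perfect_code D /\ 0 \in D
      & M = [set castmx (erefl 1%N, tm_n) x | x in mollard C D f]].

(* Main.v *)
(** The codes come from Solov'eva's concatenation.  Let V = F_2^r, let S be the
    syndrome map of the Hamming code of length 2^r - 1 and S' that of the
    extended Hamming code of length 2^r on even words.  For a permutation tau of
    V, the words (x | y) with y even and S' y = tau (S x) form a perfect code of
    length 2^(r+1) - 1.  If tau carries a regular subgroup of AGL(V) to a
    subgroup of AGL(V), lifting both groups to the coordinates, which are labelled
    by vectors, makes the code propelinear.  If tau moreover conjugates no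
    nonzero translation to a translation, the kernel is exactly the direct
    product of the two Hamming codes, of codimension 2r + 1.  Such a tau is
    given explicitly for r = 3, 4, 5, and products of permutations give all
    r >= 3.

    The kernel of a Mollard code contains the words e_ij + e_i + e_j, so every
    coordinate lies in a triple of the kernel; this is invariant under
    equivalence.  In the codes above no kernel triple meets the second block,
    since the extended Hamming code has minimum distance 4. *)

From HB Require Import structures.
From mathcomp Require Import all_boot all_order all_algebra all_fingroup all_field.
(* Last, because [isometry] also exists in MathComp. *)
Require Import Defs.

Set Implicit Arguments.
Unset Strict Implicit.
Unset Printing Implicit Defensive.

Import GRing.Theory.

Local Open Scope ring_scope.

(** * Binary vectors, unit balls and propelinear structures *)

Lemma F2_cases (c : 'F_2) : c = 0 \/ c = 1.
Proof. by case: c => [[|[|k]] ltk] //; [left | right]; apply: val_inj. Qed.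

Lemma F2_vecK n (x : 'BF_n) : x + x = 0.
Proof. by apply/rowP=> i; rewrite !mxE; case: (F2_cases (x 0 i)) => ->; apply: val_inj. Qed.

Lemma hamming_dist_le1 n (x y : 'BF_n) :
  (hamming_dist x y <= 1)%N <-> y = x \/ exists i, y = x + delta_mx 0 i.
Proof.
rewrite /hamming_dist leq_eqVlt ltnS leqn0 cards_eq0; split.
  case/orP=> [/cards1P[i Hi]|/eqP H0].
    right; exists i; apply/rowP=> j; rewrite !mxE eqxx /=.
    have := in_set1 j i; rewrite -Hi inE.
    case: (j == i) => [|/negbFE/eqP->]; last by rewrite addr0.
    by case: (F2_cases (x 0 j)) (F2_cases (y 0 j)) => -> [] -> // _; apply: val_inj.
  left; apply/rowP=> j; have := in_set0 j; rewrite -H0 inE.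
  by move/negbFE/eqP.
case=> [->|[i ->]]; apply/orP.
  by right; apply/eqP/setP=> j; rewrite !inE eqxx.
left; apply/cards1P; exists i; apply/setP=> j; rewrite !inE !mxE eqxx /=.
rewrite -[X in X != _]addr0 (inj_eq (addrI _)) eq_sym.
by case: (j == i).
Qed.

Lemma col_perm_delta n (p : 'S_n) i :
  col_perm p (delta_mx 0 i : 'BF_n) = delta_mx 0 ((p^-1)%g i).
Proof.
by apply/rowP=> j; rewrite !mxE eqxx /= -[in RHS](inj_eq (@perm_inj _ p)) permKV.
Qed.

Lemma col_permD n (p : 'S_n) (x y : 'BF_n) :
  col_perm p (x + y) = col_perm p x + col_perm p y.
Proof. by apply/rowP=> j; rewrite !mxE. Qed.

Lemma isometry_fun0 n (x : 'BF_n) (p : 'S_n) : isometry_fun x p 0 = x.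
Proof. by apply/rowP=> i; rewrite !mxE addr0. Qed.

(** The isometries [(x, pi x)] with [x] in [C] send 0 to [x], so they are distinct and transitive on
    [C]; the last condition closes them under composition. Its factors are reversed because products
    of permutations compose left to right. *)
Lemma propelinear_structure n (C : {set 'BF_n}) (pi : 'BF_n -> 'S_n) :
    0 \in C ->
    {in C &, forall x y, isometry_fun x (pi x) y \in C} ->
    {in C &, forall x y, pi (isometry_fun x (pi x) y) = (pi y * pi x)%g} ->
  propelinear C.
Proof.
move=> C0 CM piM.
pose s x := isometry x (pi x).
have s0 x : s x 0 = x.
  by rewrite permE isometry_fun0.
have s_inj : injective s by move=> x y eq_s; rewrite -[x]s0 eq_s s0.
have GS : group_set [set s x | x in C].
  apply/group_setP; split=> [|_ _ /imsetP[x Cx ->] /imsetP[y Cy ->]].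
    apply/imsetP; exists 0 => //.
    (* The condition at [x = y = 0] makes [pi 0] idempotent. *)
    have pi0 : pi 0 = 1%g.
      have := piM 0 0 C0 C0; rewrite isometry_fun0.
      by move/(congr1 (mulg (pi 0)^-1%g)); rewrite mulKg mulVg.
    by apply/permP=> z; rewrite permE permE /isometry_fun pi0 invg1 col_perm1 add0r.
  by apply/imsetP; exists (isometry_fun y (pi y) x); rewrite /s ?CM // isometryM piM.
exists (Group GS); split=> /=.
- apply/subsetP=> _ /imsetP[x Cx ->]; apply/setIP; split.
    by apply/imsetP; exists (x, pi x).
  rewrite inE; apply/andP; split; first by rewrite inE.
  rewrite inE; apply/subsetP=> y Cy.
  by rewrite inE /= apermE permE CM.
- by rewrite card_imset.
apply/imsetP; exists 0 => //; apply/setP=> x; apply/idP/orbitP => [Cx|].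
  by exists (s x); [apply: imset_f | rewrite /= apermE s0].
by case=> _ /imsetP[y Cy ->] <-; rewrite /= apermE s0.
Qed.

(** * Kernels of Mollard codes and their invariance under equivalence *)

Lemma mem_mollard_Z_kernel t m C D (f : 'BF_t -> 'BF_m) z :
  z \in mollard_Z t m -> z \in kernel (mollard C D f).
Proof.
move=> Zz; apply/kernelP=> _ /imset2P[u v Mu Zv ->].
rewrite addrCA; apply: imset2_f => //.
case/imsetP: Zz => a _ ->; case/imsetP: Zv => b _ ->; apply/imsetP; exists (a + b) => //.
rewrite /mollard_concat !add_row_mx linearD /=; congr (row_mx (row_mx _ _) _).
  by apply/rowP=> i; rewrite !mxE -big_split; apply: eq_bigr => j _; rewrite mxE.
by apply/rowP=> i; rewrite !mxE -big_split; apply: eq_bigr => j _; rewrite mxE.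
Qed.

Lemma mollard_Z_triple t m (i : 'I_t) (j : 'I_m) :
  delta_mx 0 (lshift m (lshift t (mxvec_index i j)))
    + delta_mx 0 (lshift m (rshift (t * m) i)) + delta_mx 0 (rshift (t * m + t) j)
    \in mollard_Z t m.
Proof.
apply/imsetP; exists (delta_mx i j) => //.
rewrite /mollard_concat mxvec_delta.
have -> : row_parities (delta_mx i j) = delta_mx 0 i.
  apply/rowP=> k; rewrite !mxE (bigD1 j) //= big1 => [|l nl]; rewrite !mxE ?eqxx ?andbT ?addr0 //.
  by rewrite (negPf nl) andbF.
have -> : col_parities (delta_mx i j) = delta_mx 0 j.
  apply/rowP=> k; rewrite !mxE (bigD1 i) //= big1 => [|l nl]; rewrite !mxE ?eqxx ?addr0 //.
  by rewrite (negPf nl).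
have dl a b (k : 'I_a) : delta_mx 0 (lshift b k) = row_mx (delta_mx 0 k) 0 :> 'BF_(a + b).
  apply/rowP=> l; rewrite mxE -[l]splitK; case: (split l) => l' /=;
    rewrite ?(row_mxEl, row_mxEr) mxE ?eq_lshift ?eq_rlshift //.
have dr a b (k : 'I_b) : delta_mx 0 (rshift a k) = row_mx 0 (delta_mx 0 k) :> 'BF_(a + b).
  apply/rowP=> l; rewrite mxE -[l]splitK; case: (split l) => l' /=;
    rewrite ?(row_mxEl, row_mxEr) mxE ?eq_rshift ?eq_lrshift //.
by rewrite !dl !dr !add_row_mx !addr0 !add0r.
Qed.

(** One of the triples of [mollard_Z] passes through [c], whichever block contains it; positivity of
    [t] and [m] supplies the free index when [c] is in one of the last two blocks. *)
Lemma mollard_kernel_triple n (M : {set 'BF_n}) (c : 'I_n) :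
  mollard_code M ->
  exists i j, delta_mx 0 c + delta_mx 0 i + delta_mx 0 j \in kernel M.
Proof.
case=> t [m [C [D [f [tm_n [[t_gt0 m_gt0] _ _ defM]]]]]].
case: n / tm_n M c defM => M c ->.
have -> : [set castmx (erefl 1%N, erefl (t * m + t + m)%N) x
             | x in mollard C D f] = mollard C D f.
  by rewrite -[RHS]imset_id; apply: eq_imset => x; rewrite castmx_id.
have kerT i j := mem_mollard_Z_kernel C D f (mollard_Z_triple i j).
have i0 : 'I_t := Ordinal t_gt0; have j0 : 'I_m := Ordinal m_gt0.
rewrite -[c]splitK; case: (split c) => {c}c /=; last first.
  do 2!eexists; rewrite -addrA addrC; exact: (kerT i0 c).
rewrite -[c]splitK; case: (split c) => {c}c /=; last first.
  do 2!eexists; rewrite [X in X + _]addrC; exact: (kerT c j0).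
case/mxvec_indexP: c => i j.
do 2!eexists; exact: (kerT i j).
Qed.

(** The translation part cancels, so only the permutation part acts on kernels; [col_perm p] undoes
    it. *)
Lemma equivalent_kernel n (C M : {set 'BF_n}) :
  equivalent C M ->
  exists p : 'S_n, forall z, z \in kernel M -> col_perm p z \in kernel C.
Proof.
case=> _ /imsetP[[x p] _ ->] <- /=; exists p => z /kernelP Kz.
apply/kernelP=> y Cy; have := Kz _ (imset_f _ Cy).
case/imsetP=> y' Cy'; rewrite !permE /isometry_fun addrCA => /addrI.
move=> eq_y; suff -> : col_perm p z + y = y' by [].
have := congr1 (col_perm p) eq_y.
by rewrite col_permD -!col_permM mulgV !col_perm1.
Qed.

Lemma not_mollard_of_uncovered n (C : {set 'BF_n}) (c : 'I_n) :
  (forall i j, delta_mx 0 c + delta_mx 0 i + delta_mx 0 j \notin kernel C) ->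
  ~ exists M, mollard_code M /\ equivalent C M.
Proof.
move=> noC [M [/(@mollard_kernel_triple _ _ _) M3 /equivalent_kernel[p Kp]]].
have [i [j /Kp]] := M3 (p c).
by rewrite !col_permD !col_perm_delta permK; exact/negP/noC.
Qed.

(** * Pairs of regular affine actions of one group *)

(* MathComp does not declare these joins for products. *)
HB.instance Definition _ (U V : countZmodType) := GRing.Zmodule.on (U * V)%type.
HB.instance Definition _ (U V : finZmodType) := GRing.Zmodule.on (U * V)%type.

(** The first clause is additivity of [g a x - g a 0] in [x], written without subtraction. *)
Definition affine_action (V : zmodType) (f g : V -> V -> V) : Prop :=
  forall a x y, [/\ g a (x + y) + g a 0 = g a x + g a y,
                    g a (g x y) = g (f a x) y
                  & g a x = g a y -> x = y].

(* The operation [f a b] is a group law on V; [f] is its left regular action and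
   [h] another affine action of the same group, regular as well.  The permutation
   [tau a = h a 0] intertwines them, and the last clause says that it conjugates
   no nonzero translation to a translation. *)
Definition regular_pair (V : zmodType) (f h : V -> V -> V) : Prop :=
  [/\ forall a, f a 0 = a, affine_action f f, affine_action f h,
      injective (h^~ 0)
    & forall a, (forall x, h (x + a) 0 = h x 0 + h a 0) -> a = 0].

Section FiniteCheck.

Variables (V : zmodType) (e : seq V).
Implicit Types f g h : V -> V -> V.

Definition affine_actionb f g : bool :=
  all (fun a => all (fun x => all (fun y =>
    [&& g a (x + y) + g a 0 == g a x + g a y,
        g a (g x y) == g (f a x) y
      & (g a x == g a y) ==> (x == y)]) e) e) e.

Definition regular_pairb f h : bool :=
  [&& all (fun a => f a 0 == a) e, affine_actionb f f, affine_actionb f h,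
      all (fun a => all (fun b => (h a 0 == h b 0) ==> (a == b)) e) e
    & all (fun a => (a == 0) || has (fun x => h (x + a) 0 != h x 0 + h a 0) e)
          e].

Hypothesis mem_e : forall x, x \in e.

Lemma affine_actionP f g : affine_actionb f g -> affine_action f g.
Proof.
move=> /allP fg a x y.
have /allP/(_ x (mem_e x))/allP/(_ y (mem_e y)) := fg a (mem_e a).
case/and3P=> /eqP ? /eqP ? /implyP gI; split=> // /eqP eq_g.
exact/eqP/gI.
Qed.

Lemma regular_pairP f h : regular_pairb f h -> regular_pair f h.
Proof.
case/and5P=> /allP f0 /affine_actionP ff /affine_actionP fh /allP hI /allP nt.
split=> // [a|a b eq_ab|a Ha].
- exact/eqP/f0.
- have /allP/(_ b (mem_e b)) := hI a (mem_e a).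
  by rewrite eq_ab eqxx => /eqP.
case/orP: (nt a (mem_e a)) => [/eqP //|/hasP[x _]].
by rewrite Ha eqxx.
Qed.

End FiniteCheck.

(** * Explicit pairs in dimensions 3, 4 and 5, and their products *)

Notation bits3 := (bool * bool * bool)%type.
Notation bits4 := (bits3 * bool)%type.
Notation bits5 := (bits4 * bool)%type.

Definition extend_bit (T : Type) (s : seq T) : seq (T * bool) :=
  [seq (x, b) | x <- s, b <- [:: false; true]].

Lemma mem_extend_bit (T : eqType) (s : seq T) :
  (forall x, x \in s) -> forall x, x \in extend_bit s.
Proof.
move=> mem_s [x b]; apply/allpairsP; exists (x, b) => /=.
by rewrite mem_s; case: b.
Qed.

Definition all_bits3 := extend_bit (extend_bit [:: false; true]).
Definition all_bits4 := extend_bit all_bits3.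
Definition all_bits5 := extend_bit all_bits4.

Lemma mem_all_bits3 x : x \in all_bits3.
Proof. by do 2!apply: mem_extend_bit => {}x; case: x. Qed.

(** Group elements are written as ordered words in the generators, with the bits of [a] as
    exponents. Using the same words for [f] and [h] matches the two groups. *)
Definition act3 (g1 g2 g3 : bits3 -> bits3) (a x : bits3) : bits3 :=
  let: (a1, a2, a3) := a in iter a3 g3 (iter a2 g2 (iter a1 g1 x)).

(* The generators in the next three lemmas were found by a computer search over
   pairs of isomorphic regular subgroups of the affine group. *)
Lemma regular_pair3 : exists f h : bits3 -> bits3 -> bits3, regular_pair f h.
Proof.
exists (act3 (fun '(x, y, z) => (~~ x, z, y))
             (fun '(x, y, z) => (x, ~~ y, z))
             (fun '(x, y, z) => (x, y, ~~ z))).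
exists (act3 (fun '(x, y, z) => (y, x, ~~ z))
             (fun '(x, y, z) => (x (+) z, ~~ y, z))
             (fun '(x, y, z) => (~~ x, ~~ (y (+) z), z))).
by apply: (regular_pairP mem_all_bits3); vm_compute.
Qed.

Definition act4 (g1 g2 g3 g4 : bits4 -> bits4) (a x : bits4) : bits4 :=
  let: (a1, a2, a3, a4) := a in
  iter a4 g4 (iter a3 g3 (iter a2 g2 (iter a1 g1 x))).

Lemma regular_pair4 : exists f h : bits4 -> bits4 -> bits4, regular_pair f h.
Proof.
exists (act4 (fun '(x, y, z, u) => (~~ x, y, y (+) z, y (+) u))
             (fun '(x, y, z, u) => (x (+) y, ~~ y, y (+) u, z))
             (fun '(x, y, z, u) => (x, y, ~~ z, u))
             (fun '(x, y, z, u) => (x, y, z, ~~ u))).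
exists (act4 (fun '(x, y, z, u) => (~~ (x (+) y), y, ~~ z, u))
             (fun '(x, y, z, u) => (x (+) u, z, y, ~~ u))
             (fun '(x, y, z, u) => (x (+) y, y, ~~ z, u))
             (fun '(x, y, z, u) => (x (+) z, ~~ y, z, u))).
apply: (regular_pairP (mem_extend_bit mem_all_bits3)).
by vm_compute.
Qed.

Definition act5 (g1 g2 g3 g4 g5 : bits5 -> bits5) (a x : bits5) : bits5 :=
  let: (a1, a2, a3, a4, a5) := a in
  iter a5 g5 (iter a4 g4 (iter a3 g3 (iter a2 g2 (iter a1 g1 x)))).

Lemma regular_pair5 : exists f h : bits5 -> bits5 -> bits5, regular_pair f h.
Proof.
exists (act5 (fun '(x, y, z, u, v) => (~~ x, y, z, z (+) u, y (+) v))
             (fun '(x, y, z, u, v) => (x, ~~ y, z, u, v))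
             (fun '(x, y, z, u, v) => (x, y (+) z, ~~ z, u, u (+) v))
             (fun '(x, y, z, u, v) => (x, y, z, ~~ u, v))
             (fun '(x, y, z, u, v) => (x, y, z, u, ~~ v))).
exists (act5 (fun '(x, y, z, u, v) => (~~ x, v, u, z, y))
             (fun '(x, y, z, u, v) => (x, ~~ y, z, u, x (+) v))
             (fun '(x, y, z, u, v) => (x, y (+) z, ~~ z, x (+) u, u (+) v))
             (fun '(x, y, z, u, v) => (x, y, x (+) z, ~~ (x (+) u), v))
             (fun '(x, y, z, u, v) => (x, x (+) y, z, u, ~~ (x (+) v)))).
apply: (regular_pairP (mem_extend_bit (mem_extend_bit mem_all_bits3))).
by vm_compute.
Qed.

Lemma regular_pair_prod (U V : zmodType) f h f' h' :
  @regular_pair U f h -> @regular_pair V f' h' ->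
  @regular_pair (U * V)%type (fun a x => (f a.1 x.1, f' a.2 x.2))
                             (fun a x => (h a.1 x.1, h' a.2 x.2)).
Proof.
case=> f0 ff fh hI nt [f0' ff' fh' hI' nt'].
have prodP (g : U -> U -> U) (g' : V -> V -> V) :
    affine_action f g -> affine_action f' g' ->
    @affine_action (U * V)%type (fun a x => (f a.1 x.1, f' a.2 x.2))
                                (fun a x => (g a.1 x.1, g' a.2 x.2)).
  move=> fg fg' [a a'] [x x'] [y y'] /=.
  have [gD gM gI] := fg a x y; have [gD' gM' gI'] := fg' a' x' y'.
  split; [by congr (_, _) | by rewrite gM gM' | by case=> /gI-> /gI'->].
split; [ | exact: prodP | exact: prodP | | ].
- by move=> [a a'] /=; rewrite f0 f0'.
- by move=> [x x'] [y y'] [/hI-> /hI'->].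
move=> [a a'] Ha; congr (_, _).
  by apply: nt => x; have [] := Ha (x, 0).
by apply: nt' => x; have [] := Ha (0, x).
Qed.

Lemma exists_regular_pair r : (3 <= r)%N ->
  exists (V : finZmodType) (f h : V -> V -> V),
    [/\ #|V| = (2 ^ r)%N, forall v : V, v + v = 0 & regular_pair f h].
Proof.
have [n] := ubnP r; elim: n r => // n IHn r.
have [r3|r_gt5] := leqP r 5.
  have xx (x : bool) : x + x = 0 by case: x.
  case: r r3 => [|[|[|[|[|[|r]]]]]] // _ _ _.
  - have [f [h fh]] := regular_pair3; exists bits3, f, h.
    by split; rewrite ?card_prod ?card_bool // => -[[x y] z]; congr (_, _, _).
  - have [f [h fh]] := regular_pair4; exists bits4, f, h.
    by split; rewrite ?card_prod ?card_bool // => -[[[x y] z] u]; congr (_, _, _, _).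
  - have [f [h fh]] := regular_pair5; exists bits5, f, h.
    by split; rewrite ?card_prod ?card_bool // => -[[[[x y] z] u] v]; congr (_, _, _, _, _).
rewrite ltnS => r_le _.
(* From dimension 6 on, a factor of dimension 3 is split off, which leaves dimension at least 3. *)
have [||U [f [h [cU xU fhU]]]] := IHn (r - 3)%N.
- by rewrite (leq_trans _ r_le) // ltn_subrL //; apply: leq_trans r_gt5.
- by rewrite leq_subRL // (leq_trans _ r_gt5).
have [f' [h' fh']] := regular_pair3.
exists (U * bits3)%type, (fun a x => (f a.1 x.1, f' a.2 x.2)),
       (fun a x => (h a.1 x.1, h' a.2 x.2)).
split; last exact: regular_pair_prod.
  rewrite !card_prod !card_bool cU -[(2 * 2 * 2)%N]/(2 ^ 3)%N -expnD subnK //.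
  exact: leq_trans r_gt5.
by case=> u [[[] []] []]; congr (_, _); exact: xU.
Qed.

(** * Kernel sizes, syndromes and perfect codes *)

Lemma card_kernel n (C : {set 'BF_n}) :
  #|kernel C| = (2 ^ \dim (kernel_space C))%N.
Proof.
have := card_vspace (kernel_space C); rewrite card_Fp // => <-.
by apply: eq_card => x; rewrite [RHS]mem_kernel_space.
Qed.

Section Syndrome.

Variables (W : finZmodType) (n : nat) (col : 'I_n -> W).
Hypothesis W2 : forall w : W, w + w = 0.
Implicit Types (x y : 'BF_n) (w : W).

Definition syndrome x : W := \sum_(i | x 0 i != 0) col i.

Lemma syndromeD x y : syndrome (x + y) = syndrome x + syndrome y.
Proof.
have E z : syndrome z = \sum_i if z 0 i != 0 then col i else 0.
  exact: big_mkcond.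
rewrite !E -big_split; apply: eq_bigr => i _; rewrite /= mxE.
by case: (F2_cases (x 0 i)) => ->; case: (F2_cases (y 0 i)) => -> /=; rewrite ?addr0 ?add0r ?W2.
Qed.

Lemma syndrome0 : syndrome 0 = 0.
Proof. by rewrite /syndrome big1 // => i; rewrite mxE eqxx. Qed.

Lemma syndrome_delta i : syndrome (delta_mx 0 i) = col i.
Proof.
rewrite /syndrome (big_pred1 i) // => j; rewrite mxE eqxx /=.
by case: (j == i).
Qed.

(** Reduces an isometry to an affine map of syndromes: reindexing along [p] replaces each column by
    its image under [T]. *)
Lemma syndrome_isometry x y (p : 'S_n) (T : W -> W) :
    {morph T : u v / u + v} -> (forall i, col (p i) = T (col i)) ->
  syndrome (isometry_fun x p y) = syndrome x + T (syndrome y).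
Proof.
move=> TD Tp; rewrite syndromeD; congr (_ + _).
rewrite /syndrome (big_morph T TD (_ : T 0 = 0)); last first.
  by apply: (addrI (T 0)); rewrite -TD !addr0.
rewrite (reindex_inj (@perm_inj _ p)) /=.
by apply: eq_big => [i|i _]; rewrite ?Tp // !mxE permK.
Qed.

(** The fibres of a surjective homomorphism are cosets of its kernel. *)
Lemma card_syndrome_ker : (forall w, exists x, syndrome x = w) ->
  (#|[set x | syndrome x == 0%R]| * #|W| = 2 ^ n)%N.
Proof.
move=> surj.
have -> : (2 ^ n)%N = #|{: 'BF_n}| by rewrite card_mx card_Fp // mul1n.
rewrite -[#|{: 'BF_n}|]sum1_card (partition_big syndrome xpredT) //=.
rewrite mulnC -sum_nat_const; apply: eq_bigr => w _.
have [x0 sx0] := surj w.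
rewrite sum1_card -[LHS](card_imset _ (addrI x0)).
apply: eq_card => x; rewrite [RHS]unfold_in.
apply/imsetP/eqP=> [[y]|sx].
  by rewrite inE => /eqP sy ->; rewrite syndromeD sx0 sy addr0.
exists (x - x0); last by rewrite addrC subrK.
have -> : x - x0 = x + x0 by rewrite -[LHS]addr0 -(F2_vecK x0) addrA subrK.
by rewrite inE syndromeD sx sx0 W2.
Qed.

Hypotheses (col_inj : injective col) (col_neq0 : forall i, col i != 0).

(** Since the columns are distinct and nonzero, words in the unit ball around [x] correspond to the
    syndromes [syndrome x + d] with [d] zero or a column. *)
Lemma perfect_syndrome (Q : pred W) :
    (forall w, exists! d, (d = 0 \/ exists i, d = col i) /\ Q (w + d)) ->
  perfect_code [set x | Q (syndrome x)].
Proof.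
move=> Qperf x; have [d [[dcol Qd] d_uniq]] := Qperf (syndrome x).
have ball y : (hamming_dist x y <= 1)%N -> y \in [set x | Q (syndrome x)] ->
    d = syndrome y + syndrome x /\ (y = x \/ exists i, y = x + delta_mx 0 i).
  move/hamming_dist_le1=> xy; rewrite inE => Qy; split=> //; apply: d_uniq.
  split; last by rewrite addrC -addrA W2 addr0.
  case: xy => [->|[i ->]]; [by left; rewrite W2 | right; exists i].
  by rewrite syndromeD syndrome_delta addrAC W2 add0r.
have [y [Cy xy]] : exists y, y \in [set x | Q (syndrome x)] /\
                         (hamming_dist x y <= 1)%N.
  case: dcol Qd => [->|[i ->]] Qd.
    by exists x; rewrite inE -[syndrome x]addr0 Qd; split=> //; apply/hamming_dist_le1; left.
  exists (x + delta_mx 0 i); rewrite inE syndromeD syndrome_delta; split=> //.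
  by apply/hamming_dist_le1; right; exists i.
exists y; split=> // z [Cz xz].
have [dy y_x] := ball y xy Cy; have [dz z_x] := ball z xz Cz.
have := addIr _ (etrans (esym dy) dz).
case: y_x z_x => [->|[i ->]] [->|[j ->]]; rewrite ?syndromeD ?syndrome_delta //.
- by rewrite -[LHS]addr0 => /addrI/esym/eqP; rewrite (negPf (col_neq0 j)).
- by rewrite -[RHS]addr0 => /addrI/eqP; rewrite (negPf (col_neq0 i)).
- by move/addrI/col_inj->.
Qed.

Lemma induced_perm (T : W -> W) : injective T ->
  (forall i, exists j, T (col i) = col j) ->
  exists p : 'S_n, forall i, col (p i) = T (col i).
Proof.
move=> T_inj Tcol.
have {}Tcol i : exists j, T (col i) == col j by have [j ->] := Tcol i; exists j.
have q_inj : injective (fun i => xchoose (Tcol i)).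
  move=> i j /(congr1 col); rewrite -(eqP (xchooseP (Tcol i))) -(eqP (xchooseP (Tcol j))).
  by move/T_inj/col_inj.
by exists (perm q_inj) => i; rewrite permE -(eqP (xchooseP (Tcol i))).
Qed.

End Syndrome.

(** * The concatenated code of a regular pair *)

Section Concatenation.

Variables (V : finZmodType) (f h : V -> V -> V) (n : nat).
Hypotheses (V2 : forall v : V, v + v = 0) (fh : regular_pair f h).
Variable coord : 'I_n -> bool * V.
Hypotheses (coord_inj : injective coord)
  (coordP : forall u, reflect (exists i, u = coord i) (u != 0)).

Local Notation W := (V * bool * V)%type.
Local Notation tau := (h^~ 0).

(* The coordinates are labelled by the nonzero pairs in F_2 x V: the pairs
   (0, v) with v nonzero form the Hamming block, the pairs (1, v) the extended
   one.  A syndrome consists of the Hamming syndrome of the first block, and the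
   parity and the syndrome of the second. *)
Definition column (u : bool * V) : W :=
  if u.1 then (0, true, u.2) else (u.2, false, 0).

Local Notation col := (column \o coord).
Local Notation synd := (syndrome col).

Definition concat_syndrome (w : W) : bool := ~~ w.1.2 && (w.2 == tau w.1.1).

Definition concat_code : {set 'BF_n} := [set x | concat_syndrome (synd x)].

Let W2 (w : W) : w + w = 0.
Proof. by case: w => [[a e] b]; congr (_, _, _); rewrite ?V2 //; case: e. Qed.

Lemma column_inj : injective column.
Proof. by move=> [[] u] [[] v] // [->]. Qed.

Lemma column_eq0 u : (column u == 0) = (u == 0).
Proof. by rewrite -(inj_eq column_inj); congr (_ == _). Qed.

Let col_inj : injective col := inj_comp column_inj coord_inj.

Let col_neq0 i : col i != 0.
Proof. by rewrite /= column_eq0; apply/coordP; exists i. Qed.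

Let columnP u : column u = 0 \/ exists i, column u = col i.
Proof.
have [->|/coordP[i ->]] := eqVneq u 0; first by left; apply/eqP; rewrite column_eq0.
by right; exists i.
Qed.

Let fD a x y : f a (x + y) + a = f a x + f a y.
Proof. by case: fh => f0 /(_ a x y)[<- _ _]; rewrite f0. Qed.
Let fM a x y : f a (f x y) = f (f a x) y.
Proof. by case: fh => _ /(_ a x y)[]. Qed.
Let f0 a : f a 0 = a.
Proof. by case: fh. Qed.
Let hD a x y : h a (x + y) + tau a = h a x + h a y.
Proof. by case: fh => _ _ /(_ a x y)[]. Qed.
Let hM a x y : h a (h x y) = h (f a x) y.
Proof. by case: fh => _ _ /(_ a x y)[]. Qed.
Let tau_inj : injective tau.
Proof. by case: fh. Qed.

(** [h 0 (h 0 0) = h (f 0 0) 0 = h 0 0], and [h 0] is injective. *)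
Let tau0 : tau 0 = 0.
Proof.
have hI : injective (h 0) by move=> x y; case: fh => _ _ /(_ 0 x y)[].
by apply: hI; rewrite hM f0.
Qed.

Lemma concat_syndromeP w : reflect (w = (w.1.1, false, tau w.1.1)) (concat_syndrome w).
Proof.
case: w => [[a []] b]; rewrite /concat_syndrome /=; first by right.
by apply: (iffP eqP) => [->|[]].
Qed.

Lemma perfect_concat_code : perfect_code concat_code.
Proof.
have [taui tauK tauiK] : bijective tau := injF_bij tau_inj.
apply: perfect_syndrome => //.
move=> [[a e] b].
(* Odd parity forces an error in the extended block, even parity an error in the Hamming block or
   none; the label is then determined. *)
have sol d : concat_syndrome ((a, e, b) + d) /\ (d = 0 \/ exists i, d = col i) ->
    d = if e then column (true, b + tau a) else column (false, a + taui b).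
  case=> Qd d_col; have [u du] : exists u, d = column u.
    by case: d_col => [->|[i ->]]; [exists (false, 0) | exists (coord i)].
  move: Qd; rewrite {}du; case: u => [[] u] /concat_syndromeP[];
    case: e => // _ bE.
    suff -> : u = b + tau a by [].
    by rewrite -[in RHS](addr0 a) -bE addrA V2 add0r.
  suff -> : u = a + taui b by [].
  by move: bE; rewrite addr0 => ->; rewrite tauK addrA V2 add0r.
exists (if e then column (true, b + tau a) else column (false, a + taui b)).
split=> [|d [dcol Qd]]; last by rewrite (sol d).
split; first by case: e {sol}; exact: columnP.
case: e {sol}; apply/concat_syndromeP => /=.
  by congr (_, _, _); rewrite ?addr0 // addrA V2 add0r.
by congr (_, _, _); rewrite addr0 addrA V2 add0r tauiK.
Qed.

(* The action of the linear parts of [f a] and [h a] on syndromes: in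
   characteristic 2, [f a x + a] is [f a x - f a 0]. *)
Let T a (w : W) : W := (f a w.1.1 + a, w.1.2, h a w.2 + tau a).

Let TD a : {morph T a : u v / u + v}.
Proof.
move=> [[x e] y] [[x' e'] y']; rewrite /T /=; congr (_, _, _).
  by rewrite fD addrACA V2 addr0.
by rewrite hD addrACA V2 addr0.
Qed.

Let T_inj a : injective (T a).
Proof.
case: fh => _ fI hI _ _.
move=> [[x e] y] [[x' e'] y'] [] /addIr ? -> /addIr ?.
by congr (_, _, _); [case: (fI a x x') | case: (hI a y y')] => _ _; apply.
Qed.

Let T_col a i : exists j, T a (col i) = col j.
Proof.
suff [u Tu] : exists u, T a (col i) = column u.
  case: (columnP u) => [u0|[j Du]]; last by exists j; rewrite Tu.
  case/eqP: (col_neq0 i); apply: (@T_inj a); rewrite Tu u0.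
  by congr (_, _, _); rewrite ?f0 V2.
rewrite /=; case: (coord i) => [[] u].
  by exists (true, h a u + tau a); rewrite /T /= f0 V2.
by exists (false, f a u + a); rewrite /T /= V2.
Qed.

Lemma mem0_concat_code : 0 \in concat_code.
Proof. by rewrite inE syndrome0 /concat_syndrome /= tau0. Qed.

(** A codeword [x] with Hamming syndrome [a] acts by a permutation realising [T a], followed by
    translation by [x]. The two syndromes of a codeword then move by [f a] and [h a], which [tau]
    intertwines. *)
Lemma propelinear_concat_code : propelinear concat_code.
Proof.
have pP a : exists p : 'S_n, [forall i, col (p i) == T a (col i)].
  have [p Hp] := induced_perm col_inj (@T_inj a) (T_col a).
  by exists p; apply/forallP=> i; apply/eqP.
pose pi a := xchoose (pP a).
have piT a i : col (pi a i) = T a (col i) by apply/eqP/(forallP (xchooseP (pP a))).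
pose s x := (synd x).1.1.
have synd_mul x y : x \in concat_code -> y \in concat_code ->
  synd (isometry_fun x (pi (s x)) y) = (f (s x) (s y), false, tau (f (s x) (s y))).
  rewrite !inE => /concat_syndromeP Cx /concat_syndromeP Cy.
  rewrite (@syndrome_isometry _ _ _ W2 _ _ _ _ (@TD (s x)) (piT _)).
  rewrite Cx Cy /T /= -/(s x) -/(s y); congr (_, _, _).
    by rewrite addrC -addrA V2 addr0.
  by rewrite addrC -addrA V2 addr0 hM.
apply: (@propelinear_structure _ _ (fun x => pi (s x))).
- exact: mem0_concat_code.
- by move=> x y Cx Cy; rewrite inE synd_mul //; apply/concat_syndromeP.
move=> x y Cx Cy; rewrite {1}/s synd_mul //=; apply/permP=> i.
(* Columns are distinct, so it suffices that [T (f a b)] is [T a] after [T b]. *)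
apply: col_inj; rewrite permM !piT; case: (col i) => [[u e] v]; rewrite /T /=.
congr (_, _, _); rewrite -?hM -?fM.
  by rewrite fD.
by rewrite hD.
Qed.

Lemma syndrome_surj w : exists x, synd x = w.
Proof.
have colS u : exists x, synd x = column u.
  case: (columnP u) => [->|[i ->]]; first by exists 0; rewrite syndrome0.
  by exists (delta_mx 0 i); rewrite syndrome_delta.
case: w => [[a e] b].
have [x sx] := colS (false, a); have [y sy] := colS (true, b).
(* [y] already has odd parity; [z] changes the parity alone and is added when [e] is false. *)
have [z sz] := colS (true, 0).
exists (x + y + (if e then 0 else z)).
rewrite !(syndromeD _ W2) sx sy.
suff: (a + 0 + 0, e, 0 + b + 0) = (a, e, b) by case: e; rewrite ?syndrome0 ?sz.
by rewrite !addr0 add0r.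
Qed.

(** A kernel word is itself a codeword, with Hamming syndrome [a] say. Adding it to codewords of
    every Hamming syndrome [x] gives [tau (x + a) = tau x + tau a], which forces [a = 0]. *)
Lemma kernel_concat_code : kernel concat_code = [set x | synd x == 0].
Proof.
apply/setP=> z; rewrite [RHS]inE; apply/kernelP/eqP=> [Kz|sz y]; last first.
  by rewrite !inE syndromeD // sz add0r.
have := Kz 0 mem0_concat_code; rewrite addr0 inE => /concat_syndromeP.
set a := (synd z).1.1 => sz.
suff a0 : a = 0 by rewrite sz a0 tau0.
case: fh => _ _ _ _; apply=> x.
have [y sy] := syndrome_surj (x, false, tau x).
have := Kz y; rewrite !inE syndromeD // sy sz => /(_ (introT (concat_syndromeP _) erefl)).
by case/concat_syndromeP=> /= E; rewrite [x + a]addrC -E addrC.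
Qed.

Lemma dim_kernel_concat_code r : #|V| = (2 ^ r)%N ->
  (\dim (kernel_space concat_code) + (r + 1 + r) = n)%N.
Proof.
move=> cV; have := card_syndrome_ker W2 syndrome_surj.
rewrite -kernel_concat_code card_kernel !card_prod card_bool cV.
by rewrite -expnSr -!expnD addn1 => /eqP; rewrite eqn_exp2l // => /eqP.
Qed.

Lemma concat_code_not_mollard :
  ~ exists M, mollard_code M /\ equivalent concat_code M.
Proof.
have /coordP[c Dc] : (true, 0) != 0 :> bool * V by [].
apply: (@not_mollard_of_uncovered _ _ c) => i j; rewrite kernel_concat_code inE.
rewrite !(syndromeD _ W2) !syndrome_delta /= -Dc.
apply/negP=> /eqP; have := col_neq0 i; have := col_neq0 j => /=.
(* Parity puts exactly one of [i], [j] in the extended block; the other is alone in the Hamming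
   block, so its label would be 0. *)
case: (coord i) => [[] u]; case: (coord j) => [[] v] // nz nz' [] /=; rewrite ?addr0 ?add0r.
  by move=> v0; case/eqP: nz; rewrite v0.
by move=> v0; case/eqP: nz'; rewrite v0.
Qed.

End Concatenation.

(** * Codes of length [2 ^ r.+1 - 1] with both properties *)

Lemma exists_propelinear_not_mollard r : (3 <= r)%N ->
  exists C : {set 'BF_(2 ^ r.+1 - 1)},
    [/\ perfect_code C, propelinear C,
        \dim (kernel_space C) = (2 ^ r.+1 - 2 * r - 2)%N
      & ~ exists M : {set 'BF_(2 ^ r.+1 - 1)},
            mollard_code M /\ equivalent C M].
Proof.
case/exists_regular_pair=> V [f [h [cV V2 fh]]].
set n := (2 ^ r.+1 - 1)%N.
have nE : n = #|[set~ (0 : bool * V)]|.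
  by rewrite cardsC1 card_prod card_bool cV -expnS /n subn1.
(* The length is the number of nonzero pairs in [bool * V], which are enumerated as labels. *)
pose coord (i : 'I_n) : bool * V := enum_val (cast_ord nE i).
have coord_inj : injective coord := inj_comp enum_val_inj (@cast_ord_inj _ _ nE).
have coordP u : reflect (exists i, u = coord i) (u != 0).
  apply: (iffP idP) => [u0|[i ->]].
    have uS : u \in [set~ (0 : bool * V)] by rewrite !inE.
    exists (cast_ord (esym nE) (enum_rank_in uS u)).
    by rewrite /coord cast_ordKV enum_rankK_in.
  by have := enum_valP (cast_ord nE i); rewrite !inE.
exists (concat_code h coord); split.
- exact: (perfect_concat_code V2 fh).
- exact: (propelinear_concat_code V2 fh).
- have := dim_kernel_concat_code V2 fh coordP cV.
  move=> dimE; rewrite -[LHS](addnK (r + 1 + r)) dimE /n -!subnDA.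
  by rewrite mul2n -addnn addn1 addn2 add1n addSn.
exact: (concat_code_not_mollard V2 fh).
Qed.

Local Close Scope ring_scope.

Theorem mainTheorem8 :
  (forall r : nat, 3 <= r ->
     exists C : {set 'BF_(2 ^ r.+1 - 1)},
       [/\ perfect_code C, propelinear C
         & \dim (kernel_space C) = 2 ^ r.+1 - 2 * r - 2])
  /\
  (forall r : nat, 3 <= r ->
     exists C : {set 'BF_(2 ^ r.+1 - 1)},
       [/\ perfect_code C, propelinear C
         & ~ exists M : {set 'BF_(2 ^ r.+1 - 1)},
               mollard_code M /\ equivalent C M]).
Proof.
by split=> r /exists_propelinear_not_mollard[C [? ? ? ?]]; exists C.
Qed.
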